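(* If $P_{2,0}^{[d]} \trianglelefteq_{\textup{aff}} P_{1,2}^{[e]}$, then $e \ge \exp(d)$, i.e. $e\ge 2^{\Omega(d)}$.
   Context: $P^{[d]}_{2,0} := x_1\cdots x_d + x_{d+1}\cdots x_{2d}$ (the binomial, in $2d$ variables) and $P^{[e]}_{1,2} := z_1\cdots z_e + z_{e+1}^e + z_{e+2}^e$ (in $e+2$ variables). For polynomials $f$ in variables $x\in\mathbb{C}^n$ and $g$ in variables $w\in\mathbb{C}^N$, $f\trianglelefteq_{\textup{aff}} g$ means $f$ lies in the closure of $\{x\mapsto g(Ax+b): A\in\mathbb{C}^{N\times n},\, b\in\mathbb{C}^N\}$. *)

(* Defs.v *)
From HB Require Import structures.
From mathcomp Require Import all_boot all_order all_algebra.
From mathcomp Require Import mpoly.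

Set Implicit Arguments.
Unset Strict Implicit.
Unset Printing Implicit Defensive.

Import Order.TTheory GRing.Theory Num.Theory.
Local Open Scope ring_scope.

Definition P20 (C : comNzRingType) (d : nat) : {mpoly C[d + d]} :=
  \prod_(i < d) 'X_(lshift d i) + \prod_(i < d) 'X_(rshift d i).

Definition P12 (C : comNzRingType) (e : nat) : {mpoly C[e + 2]} :=
  \prod_(i < e) 'X_(lshift 2 i)
  + 'X_(rshift e (0 : 'I_2)) ^+ e + 'X_(rshift e (1 : 'I_2)) ^+ e.

(* The polynomial x |-> g (A x + b). *)
Definition affine_subst (C : comNzRingType) (n N : nat) (g : {mpoly C[N]})
    (A : 'M[C]_(N, n)) (b : 'cV[C]_N) : {mpoly C[n]} :=
  g \mPo [tuple \sum_(j < n) A i j *: 'X_j + (b i 0)%:MP | i < N].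

(* Membership of f in the closure of { g (A x + b) }, for the sup distance on
   coefficients.  All the polynomials g (A x + b) lie in the finite-dimensional
   space of polynomials of degree at most deg g, where every norm gives the same
   closure; over the complex numbers it is also the Zariski closure, the set
   being constructible.  In a numFieldType, 0 < eps forces eps to be real. *)
Definition aff_degen (C : numFieldType) (n N : nat)
    (f : {mpoly C[n]}) (g : {mpoly C[N]}) : Prop :=
  forall eps : C, 0 < eps ->
    exists (A : 'M[C]_(N, n)) (b : 'cV[C]_N),
      forall m : 'X_{1..n}, `|(affine_subst g A b)@_m - f@_m| < eps.

(* Main.v *)
Require Import Defs.
From mathcomp Require Import all_boot all_order all_algebra complex.
From mathcomp Require Import mpoly.
From mathcomp Require Import reals exp.
From mathcomp Require Import ring lra zify.

Set Implicit Arguments.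
Unset Strict Implicit.
Unset Printing Implicit Defensive.

Import Order.TTheory GRing.Theory Num.Theory.
Import Normc.
Local Open Scope ring_scope.

(** Suppose that [g = l_1 ... l_e + a^e + b^e], with affine forms [l_r], [a],
    [b], is close to [x_1 ... x_d + y_1 ... y_d].

    - In the x-space, moving along the kernel of the x-parts of [a] and [b]
      changes [x_1 ... x_d] from [1] to [0] without changing [a^e + b^e].  So the
      product [l_1 ... l_e] has modulus at least [1/4] at one of the two points.
    - From there, move in the y-space along the kernel of the y-parts of [a] and
      [b], which is parametrized by [w] with all but two coordinates free.  The
      two pivot coordinates start at [1] and the others at [0], so that
      [y_1 ... y_d] has lowest term [prod w] of degree [D = d - 2].  Along
      this motion [g] is [c * prod_r (1 + t m_r(w))] plus a constant.  The
      coefficients of degree [0 < k < D] in [t] are therefore small, and the one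
      of degree [D] is close to [prod w].
    - Since [c] is bounded below, Newton's identities give
      [c * sum_r m_r(w)^D ~ (-1)^(D-1) D prod w].
    - At [w = s + s'] with sign vectors [s], [s'], the right-hand side vanishes
      unless [s = s'], whereas the left-hand side, as a matrix indexed by [s] and
      [s'], has rank at most [e (D + 1)].  Hence [2^D <= e (D + 1)].

    Parameters of all motions are bounded independently of the forms: this is
    why the kernels are parametrized with bounded coefficients. *)

(** * The complex modulus with values in the real field *)

Section ComplexModulus.
Variable R : rcfType.
Implicit Types x y : R[i].

Lemma normc_ge0 x : 0 <= normc x.
Proof. by case: x => a b; apply: sqrtr_ge0. Qed.

Lemma normr_normc x : `|x| = (normc x)%:C%C.
Proof. by rewrite normc_def; case: x. Qed.

Lemma normc_sum (I : Type) (r : seq I) (P : pred I) (F : I -> R[i]) :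
  normc (\sum_(i <- r | P i) F i) <= \sum_(i <- r | P i) normc (F i).
Proof. exact: (@ler_norm_sum R (Rcomplex R)). Qed.

Lemma normc_prod (I : Type) (r : seq I) (P : pred I) (F : I -> R[i]) :
  normc (\prod_(i <- r | P i) F i) = \prod_(i <- r | P i) normc (F i).
Proof. exact: (big_morph _ (@normcM R) (@normc1 R)). Qed.

Lemma normcX x n : normc (x ^+ n) = normc x ^+ n.
Proof. by elim: n => [|n IH]; rewrite ?expr0 ?normc1 // !exprS normcM IH. Qed.

Lemma normc_nat n : normc (n%:R : R[i]) = n%:R.
Proof. by rewrite normcMn normc1. Qed.

Lemma normc_gt0 x : (0 < normc x) = (x != 0).
Proof.
rewrite lt0r normc_ge0 andbT; congr (~~ _); apply/eqP/eqP => [/eq0_normc //|->].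
exact: normc0.
Qed.

End ComplexModulus.

(** * Rank bound from diagonal dominance *)

Section DiagonalDominance.
Variable R : rcfType.

(** If [r < n], some nonzero [v] satisfies [v *m U = 0]. In the column where [v] has its largest
    entry, the diagonal term of [v *m (U *m W) = 0] outweighs all the others. *)
Lemma diag_dominant_factor (n r : nat) (U : 'M[R[i]]_(n, r))
    (W : 'M[R[i]]_(r, n)) (delta : R) :
  (forall s, 1 <= normc ((U *m W) s s)) ->
  (forall s t, s != t -> normc ((U *m W) s t) <= delta) ->
  n%:R * delta < 1 -> (n <= r)%N.
Proof.
move=> diag off small; rewrite leqNgt; apply/negP => ltrn.
have : kermx U != 0.
  rewrite kermx_eq0 -row_leq_rank -ltnNge.
  exact: leq_ltn_trans (rank_leq_col U) ltrn.
case/rowV0Pn => v /sub_kermxP vU v0.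
have vM : v *m (U *m W) = 0 by rewrite mulmxA vU mul0mx.
have [s0 vs0] : exists s, v 0 s != 0.
  by apply/existsP; apply: contraNT v0 => /existsPn H; apply/eqP/rowP => s;
     move: (H s); rewrite negbK mxE => /eqP.
have [/= t _ tmax] := arg_maxP (fun s => normc (v 0 s)) (isT : predT s0).
have vt : 0 < normc (v 0 t).
  by apply: lt_le_trans (tmax s0 isT); rewrite normc_gt0.
(* The sign comes from an off-diagonal entry of column [t]. A 1 by 1 matrix has none, but there [v]
   would annihilate a nonzero entry. *)
have d0 : 0 <= delta.
  case: (pickP (fun s => s != t)) => [s st|none].
    exact: le_trans (normc_ge0 _) (off _ _ st).
  have : (v *m (U *m W)) 0 t = 0 by rewrite vM mxE.
  rewrite mxE (bigD1 t) //= big_pred0 // addr0 => /(congr1 (@normc R)).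
  by rewrite normcM normc0 => /eqP; rewrite mulf_eq0 !gt_eqF // (lt_le_trans _ (diag t)).
have : normc (v 0 t) <= n%:R * delta * normc (v 0 t).
  have /eqP : (v *m (U *m W)) 0 t = 0 by rewrite vM mxE.
  rewrite mxE (bigD1 t) //= addr_eq0 => /eqP e.
  apply: (@le_trans _ _ (normc (v 0 t * (U *m W) t t))).
    by rewrite normcM ler_peMr ?normc_ge0.
  rewrite e normcN; apply: le_trans (normc_sum _ _ _) _.
  apply: (@le_trans _ _ (\sum_(s < n | s != t) delta * normc (v 0 t))).
    apply: ler_sum => s st; rewrite normcM mulrC.
    by apply: ler_pM; rewrite ?normc_ge0 ?off ?tmax.
  apply: (@le_trans _ _ (\sum_(s < n) delta * normc (v 0 t))).
    by rewrite [leRHS](bigID (fun s => s != t)) /= lerDl sumr_ge0 // => s _;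
       rewrite mulr_ge0 ?normc_ge0.
  by rewrite sumr_const card_ord -mulrA mulr_natl.
by rewrite ler_pMl // leNgt small.
Qed.

Lemma diag_dominant_card (I K : finType) (U : I -> K -> R[i])
    (W : K -> I -> R[i]) (delta : R) :
  (forall s, 1 <= normc (\sum_k U s k * W k s)) ->
  (forall s t, s != t -> normc (\sum_k U s k * W k t) <= delta) ->
  #|I|%:R * delta < 1 -> (#|I| <= #|K|)%N.
Proof.
move=> diag off small.
pose U' := \matrix_(s < #|I|, k < #|K|) U (enum_val s) (enum_val k).
pose W' := \matrix_(k < #|K|, s < #|I|) W (enum_val k) (enum_val s).
have UW s t : (U' *m W') s t = \sum_k U (enum_val s) k * W k (enum_val t).
  rewrite mxE [RHS](reindex (enum_val : 'I_#|K| -> K)) /=;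
      last exact/onW_bij/enum_val_bij.
  by apply: eq_bigr => k _; rewrite !mxE.
apply: (@diag_dominant_factor _ _ U' W' delta) => // [s|s t st]; rewrite UW //.
by apply: off; rewrite (inj_eq enum_val_inj).
Qed.

End DiagonalDominance.

(** * Bounding coefficients by values *)

Section Interpolation.
Variable R : rcfType.

(** The inverse Vandermonde matrix at the nodes [0, ..., n - 1] recovers the coefficients, so [K]
    depends on [n] alone. *)
Lemma coef_bound_of_values (n : nat) : exists K : R, 0 < K /\
  forall (q : {poly R[i]}) (delta : R), 0 <= delta -> (size q <= n)%N ->
    (forall j, (j < n)%N -> normc q.[j%:R] <= delta) ->
    forall k, normc q`_k <= K * delta.
Proof.
pose a := \row_(j < n) (j%:R : R[i]).
pose V := Vandermonde n a.
have Vu : V \in unitmx.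
  rewrite unitmxE unitfE det_Vandermonde prodf_seq_neq0; apply/allP => i _ /=.
  rewrite prodf_seq_neq0; apply/allP => j _; apply/implyP => ij.
  by rewrite !mxE subr_eq0 eqr_nat gtn_eqF.
pose S := \sum_i \sum_j normc (invmx V i j).
have S0 : 0 <= S by rewrite sumr_ge0 // => i _; rewrite sumr_ge0 // => j _; exact: normc_ge0.
(* The added 1 keeps the constant positive when [n = 0]. *)
exists (1 + S); split; first by lra.
move=> q delta d0 sq val k.
have [kn|nk] := ltnP k n; last first.
  by rewrite nth_default ?normc0 ?(leq_trans sq) // mulr_ge0 //; lra.
pose u := \row_(i < n) q`_i.
have uV : u *m V = \row_(j < n) q.[j%:R].
  apply/rowP => j; rewrite !mxE (horner_coef_wide _ sq).
  by apply: eq_bigr => i _; rewrite !mxE.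
have -> : q`_k = ((\row_(j < n) q.[j%:R]) *m invmx V) 0 (Ordinal kn).
  by rewrite -uV mulmxK // mxE.
rewrite mxE; apply: le_trans (normc_sum _ _ _) _.
apply: (@le_trans _ _ (\sum_j normc (invmx V j (Ordinal kn)) * delta)).
  apply: ler_sum => j _; rewrite normcM mulrC ler_wpM2l ?normc_ge0 //.
  by rewrite mxE val.
rewrite -mulr_suml ler_wpM2r //.
apply: (@le_trans _ _ S); last by lra.
apply: ler_sum => j _; rewrite (bigD1 (Ordinal kn)) //= lerDl.
by rewrite sumr_ge0 // => i _; exact: normc_ge0.
Qed.

End Interpolation.

(** * Newton's identities and their stability *)

Section Newton.

Lemma deriv_prod (C : comNzRingType) (I : finType) (F : I -> {poly C}) :
  (\prod_i F i)^`() = \sum_i (F i)^`() * \prod_(l | l != i) F l.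
Proof.
have: uniq (index_enum I) by exact: index_enum_uniq.
elim: (index_enum I) => [|x s IH] /=; first by rewrite !big_nil -polyC1 derivC.
case/andP => xs us; rewrite !big_cons eqxx /= derivM IH // mulr_sumr.
congr (_ * _ + _).
  rewrite [RHS]big_mkcond [LHS]big_seq [RHS]big_seq.
  by apply: eq_bigr => l ls; rewrite (memPn xs).
rewrite !big_seq; apply: eq_bigr => i si.
by rewrite big_cons eq_sym (memPn xs) // mulrCA.
Qed.

Lemma newton_identity (C : comNzRingType) (e : nat) (m : 'I_e -> C) (k : nat) :
  let P := \prod_(i < e) (1 + m i *: 'X) in
  P`_k.+1 *+ k.+1
  = \sum_(j < k.+1) (-1) ^+ j * (\sum_(i < e) m i ^+ j.+1) * P`_(k - j).
Proof.
move=> P.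
pose Q i := \prod_(l < e | l != i) (1 + m l *: 'X).
have PQ i : P = (1 + m i *: 'X) * Q i by rewrite /P (bigD1 i).
(* [Q i] is [P] divided by [1 + m i *: 'X], hence the product of [P] with a geometric series.
   Summing [m i *: Q i] then gives the derivative of [P]. *)
have Qk i n : (Q i)`_n = \sum_(j < n.+1) (- m i) ^+ j * P`_(n - j).
  elim: n => [|n IH].
    by rewrite big_ord1 expr0 mul1r (PQ i) mulrDl mul1r -scalerAl coefD coefZ coefXM mulr0 addr0.
  rewrite big_ord_recl expr0 mul1r subn0.
  have -> : \sum_(j < n.+1) (- m i) ^+ lift ord0 j * P`_(n.+1 - lift ord0 j)
            = - m i * (Q i)`_n.
    rewrite IH mulr_sumr; apply: eq_bigr => j _.
    by rewrite /= /bump add1n subSS exprS mulrA.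
  by rewrite (PQ i) mulrDl mul1r -scalerAl coefD coefZ coefXM /= mulNr addrK.
have dP : P^`() = \sum_i m i *: Q i.
  rewrite /P deriv_prod /=; apply: eq_bigr => i _.
  by rewrite derivD derivZ derivX -polyC1 derivC add0r alg_polyC mul_polyC.
rewrite -coef_deriv dP coef_sum.
under eq_bigr => i _ do rewrite coefZ Qk mulr_sumr.
rewrite exchange_big; apply: eq_bigr => j _.
rewrite mulr_sumr mulr_suml; apply: eq_bigr => i _.
by rewrite (exprNn (m i)) (exprS (m i)) !mulrA [m i * _]mulrC.
Qed.

End Newton.

Section NewtonPerturbation.
Variable R : rcfType.

(** By strong induction, [c * p k] is at most [2 * D * eta] for [0 < k < D]. In degree [D] the error
    is at most [D * eta] from the top coefficient and [D * eta] from the products of lower terms. *)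
Lemma power_sum_approx (e D : nat) (m : 'I_e -> R[i]) (c w : R[i]) (eta : R) :
  let P := \prod_(i < e) (1 + m i *: 'X) in
  (0 < D)%N -> 4^-1 <= normc c -> 0 <= eta -> 8 * D%:R * eta <= 1 ->
  (forall k, (0 < k < D)%N -> normc (c * P`_k) <= eta) ->
  normc (c * P`_D - w) <= eta ->
  normc (c * (\sum_(i < e) m i ^+ D) - (-1) ^+ D.-1 * D%:R * w)
    <= 2 * D%:R * eta.
Proof.
move=> P D0 c4 eta0 small lowP topP.
pose p k := \sum_(i < e) m i ^+ k.
have P0 : P`_0 = 1.
  rewrite -horner_coef0 horner_prod big1 // => i _.
  by rewrite !hornerE.
have Pk k : (0 < k < D)%N -> normc P`_k <= 4 * eta.
  move=> /lowP; rewrite normcM => h.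
  have := normc_ge0 P`_k; nra.
have newton k : c * p k.+1 =
    (-1) ^+ k * (k.+1%:R * (c * P`_k.+1)
      - \sum_(j < k) (-1) ^+ j * (c * p j.+1) * P`_(k - j)).
  have := newton_identity m k; cbv zeta; rewrite -/P big_ord_recr /= subnn P0 mulr1 -/(p _).
  rewrite -[_ *+ k.+1]mulr_natl => h.
  have -> : k.+1%:R * (c * P`_k.+1) = c * (k.+1%:R * P`_k.+1) by ring.
  rewrite h (mulrDr c) [c * (\sum_(i < k) _)]mulr_sumr addrAC.
  have -> : \sum_(i < k) c * ((-1) ^+ i * (\sum_(i0 < e) m i0 ^+ i.+1) * P`_(k - i))
     = \sum_(j < k) (-1) ^+ j * (c * p j.+1) * P`_(k - j).
    by apply: eq_bigr => j _; rewrite -/(p _); ring.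
  by rewrite subrr add0r mulrCA [X in _ = c * X]mulrA -expr2 sqrr_sign mul1r.
(* There are fewer than [D] terms, each at most [(2 * D * eta) * (4 * eta)]; [8 * D * eta <= 1]
   makes this quadratic bound linear. *)
have tail k : (k < D)%N -> (forall j, (0 < j < k.+1)%N -> normc (c * p j) <= 2 * D%:R * eta) ->
    normc (\sum_(j < k) (-1) ^+ j * (c * p j.+1) * P`_(k - j)) <= D%:R * eta.
  move=> kD hp; apply: le_trans (normc_sum _ _ _) _.
  apply: (@le_trans _ _ (\sum_(j < k) (2 * D%:R * eta) * (4 * eta))).
    apply: ler_sum => j _; rewrite 2!normcM normcX normcN normc1 expr1n mul1r.
    apply: ler_pM; rewrite ?normc_ge0 //.
      by apply: hp; rewrite ltnS /=; case: j.
    by apply: Pk; case: j => j /= jk; lia.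
  rewrite sumr_const card_ord -[_ *+ k]mulr_natl.
  have kD' : (k%:R : R) <= D%:R by rewrite ler_nat ltnW.
  have k0 : (0 : R) <= k%:R by rewrite ler0n.
  have t0 : 0 <= eta * (D%:R * eta) by rewrite !mulr_ge0 ?ler0n.
  have : k%:R * (2 * D%:R * eta * (4 * eta)) <= D%:R * (2 * D%:R * eta * (4 * eta)).
    by apply: ler_wpM2r => //; rewrite !mulr_ge0 ?ler0n.
  move=> h; apply: le_trans h _.
  have -> : D%:R * (2 * D%:R * eta * (4 * eta)) = (8 * D%:R * eta) * (D%:R * eta) by ring.
  by rewrite ler_piMl // mulr_ge0 ?ler0n.
have low k : (0 < k < D)%N -> normc (c * p k) <= 2 * D%:R * eta.
  elim/ltn_ind: k => -[//|k] IH /andP[_ kD].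
  rewrite newton normcM normcX normcN normc1 expr1n mul1r.
  apply: le_trans (le_normcD _ _) _; rewrite normcN.
  have h1 : normc (k.+1%:R * (c * P`_k.+1)) <= D%:R * eta.
    rewrite normcM normc_nat; apply: ler_pM; rewrite ?ler0n ?normc_ge0 ?lowP //.
    by rewrite ler_nat ltnW.
  have h2 := tail k (ltnW kD).
  have : normc (\sum_(j < k) (-1) ^+ j * (c * p j.+1) * P`_(k - j)) <= D%:R * eta.
    by apply: h2 => j /andP[j0 jk]; apply: IH => //; rewrite j0 (ltn_trans jk).
  by move=> h4; move: h1 h4; lra.
case: D D0 small lowP topP Pk tail low => // D _ small lowP topP Pk tail low.
rewrite -/(p _) newton /= -mulrA -mulrBr normcM normcX normcN normc1 expr1n mul1r.
have -> : D.+1%:R * (c * P`_D.+1)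
     - \sum_(j < D) (-1) ^+ j * (c * p j.+1) * P`_(D - j) - D.+1%:R * w
  = D.+1%:R * (c * P`_D.+1 - w) 
     - \sum_(j < D) (-1) ^+ j * (c * p j.+1) * P`_(D - j) by ring.
apply: le_trans (le_normcD _ _) _; rewrite normcN.
have h1 : normc (D.+1%:R * (c * P`_D.+1 - w)) <= D.+1%:R * eta.
  by rewrite normcM normc_nat ler_wpM2l ?ler0n.
by have h2 := tail D (ltnSn D) low; move: h1 h2; lra.
Qed.

End NewtonPerturbation.

(** * Kernels of linear forms with bounded parametrizations *)

Section KernelParametrization.
Variable R : rcfType.

(** Coordinate [i] is solved for in terms of the others. Taking [a i 0] of largest modulus keeps the
    quotients at most 1, whatever [a] is. *)
Lemma kernel_one_form (n : nat) (Q : pred 'I_n) (i0 : 'I_n) (a : 'cV[R[i]]_n) :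
  Q i0 -> (forall k, ~~ Q k -> a k 0 = 0) ->
  exists i (E : 'M[R[i]]_n), [/\ Q i, forall k l, normc (E k l) <= 1,
    E *m a = 0, forall l, E i l = 0 &
    forall (w : 'rV_n) l, l != i -> (w *m E) 0 l = w 0 l].
Proof.
move=> Qi0 supp.
have [/= i Qi imax] := arg_maxP (fun k => normc (a k 0)) Qi0.
have amax k : normc (a k 0) <= normc (a i 0).
  by case: (boolP (Q k)) => [/imax //|/supp ->]; rewrite normc0 normc_ge0.
(* If [a = 0], division by zero yields 0 and [E] just erases coordinate [i]. *)
pose E := \matrix_(k, l) if l == i then if k == i then 0 else - (a k 0 / a i 0)
                         else (k == l)%:R.
exists i, E; split=> // [k l|||w l li].
- rewrite mxE; case: eqP => [_|_]; last by case: (_ == _); rewrite ?normc0 ?normc1 ?ler01.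
  case: eqP => [_|_]; first by rewrite normc0 ler01.
  rewrite normcN normcM normcV.
  have [ai0|ai0] := eqVneq (a i 0) 0; first by rewrite ai0 normc0 invr0 mulr0 ler01.
  by rewrite ler_pdivrMr ?normc_gt0 // mul1r.
- apply/colP => k; rewrite !mxE (bigD1 i) //= mxE eqxx.
  have -> : \sum_(l | l != i) E k l * a l 0 = if k == i then 0 else a k 0.
    case: eqP => [->|/eqP ki].
      apply: big1 => l li; rewrite mxE (negbTE li) eq_sym (negbTE li) mul0r //.
    rewrite (bigD1 k) //= mxE (negbTE ki) eqxx mul1r big1 ?addr0 // => l /andP[li lk].
    by rewrite mxE (negbTE li) eq_sym (negbTE lk) mul0r.
  case: eqP => _; first by rewrite mul0r addr0.
  have [ai0|ai0] := eqVneq (a i 0) 0; last by rewrite mulNr divfK // addNr.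
  rewrite ai0 mulr0 add0r; apply: eq0_normc; apply/eqP.
  by rewrite eq_le normc_ge0 (le_trans (amax k)) // ai0 normc0.
- by move=> l; rewrite mxE eqxx; case: eqP => // /eqP; rewrite eq_sym => /negbTE ->.
- rewrite mxE (bigD1 l) //= mxE (negbTE li) eqxx mulr1 big1 ?addr0 // => k kl.
  by rewrite mxE (negbTE li) (negbTE kl) mulr0.
Qed.

(** Two eliminations are composed. Row [i] of [E] is zero, so [E *m b] vanishes at [i] and the
    second pivot can be chosen different from [i]. *)
Lemma kernel_two_forms (n : nat) (a b : 'cV[R[i]]_n.+2) :
  exists i j (E : 'M[R[i]]_n.+2), [/\ i != j, forall k l, normc (E k l) <= n.+2%:R,
    E *m a = 0, E *m b = 0 &
    forall (w : 'rV_n.+2) l, l != i -> l != j -> (w *m E) 0 l = w 0 l].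
Proof.
have [|i [E [_ E1 Ea Ei Ew]]] := @kernel_one_form _ predT ord0 a isT; first by [].
pose Q : pred 'I_n.+2 := predC1 i.
have [i0 Qi0] : exists i0, Q i0.
  have [i0|i0] := eqVneq i ord0; last by exists ord0; rewrite /Q /= eq_sym.
  by exists ord_max; rewrite /Q /= i0.
have [k|j [E' [Qj E1' Eb _ Ew']]] := @kernel_one_form _ Q i0 (E *m b) Qi0.
  rewrite negbK => /eqP ->; rewrite mxE big1 // => l _.
  by rewrite Ei mul0r.
exists i, j, (E' *m E); split.
- by rewrite eq_sym.
- move=> k l; rewrite mxE; apply: le_trans (normc_sum _ _ _) _.
  apply: (@le_trans _ _ (\sum_(s < n.+2) 1)); last by rewrite sumr_const card_ord.
  by apply: ler_sum => s _; rewrite normcM mulr_ile1 ?normc_ge0.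
- by rewrite -mulmxA Ea mulmx0.
- by rewrite -mulmxA.
- by move=> w l li lj; rewrite mulmxA Ew // Ew'.
Qed.

End KernelParametrization.

(** * From coefficientwise to pointwise approximation *)

Section PointwiseApproximation.

Lemma msize_prod_le (C : comNzRingType) (n : nat) (I : Type) (r : seq I)
    (F : I -> {mpoly C[n]}) :
  (msize (\prod_(i <- r) F i) <= 1 + \sum_(i <- r) (msize (F i)).+1)%N.
Proof.
elim: r => [|i r IH]; first by rewrite !big_nil msize1.
by rewrite !big_cons; apply: leq_trans (msizeM_le _ _) _; lia.
Qed.

Lemma msize_exp_le (C : comNzRingType) (n k : nat) (p : {mpoly C[n]}) :
  (msize (p ^+ k) <= 1 + k * (msize p).+1)%N.
Proof.
elim: k => [|k IH]; first by rewrite expr0 msize1.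
by rewrite exprS; apply: leq_trans (msizeM_le _ _) _; lia.
Qed.

(** Uniformity in [A] and [b] fixes a finite set of monomials before [eps] is chosen. *)
Lemma msize_affine_subst (C : numFieldType) (n N : nat) (g : {mpoly C[N]}) :
  exists K, forall A b, (msize (@affine_subst C n N g A b) <= K)%N.
Proof.
(* An affine form has [msize] at most 2; the 3 is its successor, as in [msize_exp_le]. *)
exists (\max_(m <- msupp g) (1 + \sum_(i < N) (1 + m i * 3).+1))%N => A b.
rewrite /affine_subst comp_mpolyE; apply: leq_trans (msize_sum _ _ _) _.
elim/big_ind2: _ => // [x1 x2 y1 y2 h1 h2|m _].
  by rewrite geq_max !leq_max h1 h2 orbT.
apply: leq_trans (msizeZ_le _ _) _; apply: leq_trans (msize_prod_le _ _) _.
rewrite leq_add2l; apply: leq_sum => i _; rewrite ltnS.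
apply: leq_trans (msize_exp_le _ _) _; rewrite leq_add2l leq_mul2l ltnS.
apply/orP; right; rewrite tnth_mktuple; apply: leq_trans (msizeD_le _ _) _.
rewrite geq_max mmeasureC ?mdeg0 // (leq_trans (leq_b1 _)) // andbT.
apply: leq_trans (msize_sum _ _ _) _; apply/bigmax_leqP => j _.
by apply: leq_trans (msizeZ_le _ _) _; rewrite msizeX mdeg1.
Qed.

(** On the polydisc of radius [B] the error is at most [eps * S], where [S] sums the monomials at
    [|B|]; hence [eps = delta / (1 + S)]. *)
Lemma aff_degen_pointwise (R : rcfType) (n N : nat) (f : {mpoly R[i][n]})
    (g : {mpoly R[i][N]}) (B delta : R) :
  0 < delta -> aff_degen f g ->
  exists A b, forall x : 'I_n -> R[i], (forall i, normc (x i) <= B) ->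
    normc ((affine_subst g A b).@[x] - f.@[x]) <= delta.
Proof.
move=> d0 degen.
have [K gK] := msize_affine_subst n g.
pose k := maxn K (msize f).
pose S := \sum_(m : 'X_{1..n < k}) \prod_(i < n) `|B| ^+ m i.
have S0 : 0 <= S by rewrite sumr_ge0 // => m _; rewrite prodr_ge0 // => i _; rewrite exprn_ge0.
have e0 : 0 < (delta / (1 + S))%:C%C :> R[i].
  by rewrite ltcR divr_gt0 //; lra.
have [A [b close]] := degen _ e0; exists A, b => x xB.
rewrite -mevalB; set p := affine_subst g A b - f.
have pk : (msize p <= k)%N.
  by apply: leq_trans (msizeD_le _ _) _; rewrite msizeN geq_max !leq_max gK leqnn orbT.
rewrite (mpolywE pk) raddf_sum /=; apply: le_trans (normc_sum _ _ _) _.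
apply: (@le_trans _ _ (\sum_(m : 'X_{1..n < k}) delta / (1 + S) * \prod_(i < n) `|B| ^+ m i)).
  apply: ler_sum => m _; rewrite mevalZ mevalX normcM normc_prod.
  apply: ler_pM.
  - exact: normc_ge0.
  - by apply: prodr_ge0 => i _; exact: normc_ge0.
  - by have := close m; rewrite -mcoeffB normr_normc ltcR => /ltW.
  - apply: ler_prod => i _; rewrite normcX exprn_ge0 ?normc_ge0 //=.
    by rewrite lerXn2r ?nnegrE ?normc_ge0 // (le_trans (xB i)) ?ler_norm.
rewrite -mulr_sumr -/S mulrAC ler_pdivrMr; last by lra.
by rewrite ler_pM2l //; lra.
Qed.

End PointwiseApproximation.

(** * Coordinate products along kernel directions *)

Lemma card_setC_pair (n : nat) (i j : 'I_n.+2) : i != j -> #|~: [set i; j]| = n.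
Proof. by move=> ij; rewrite cardsCs setCK cards2 card_ord ij !subSS subn0. Qed.

Lemma card_predC_pair (n : nat) (i j : 'I_n.+2) : i != j ->
  #|(fun k : 'I_n.+2 => (k != i) && (k != j))| = n.
Proof.
move=> ij; rewrite -[RHS](card_setC_pair ij).
by apply: eq_card => k; rewrite !inE negb_or.
Qed.

(** Three coordinates leave an index [k0] that is not a pivot. Subtracting row [k0] of [E] from the
    all-ones vector cancels coordinate [k0]. *)
Lemma kernel_shift_prod0 (R : rcfType) (n : nat) (a b : 'cV[R[i]]_n.+3) :
  exists X : 'rV[R[i]]_n.+3, [/\ X *m a = const_mx 1 *m a,
    X *m b = const_mx 1 *m b, \prod_k X 0 k = 0 &
    forall k, normc (X 0 k) <= n.+4%:R].
Proof.
have [i [j [E [ij EB Ea Eb Ew]]]] := kernel_two_forms a b.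
have [k0 ki kj] : exists2 k0 : 'I_n.+3, k0 != i & k0 != j.
  have : (0 < #|~: [set i; j]|)%N by rewrite card_setC_pair.
  by case/card_gt0P => k; rewrite !inE negb_or => /andP[ki kj]; exists k.
exists (const_mx 1 - delta_mx 0 k0 *m E); split.
- by rewrite mulmxBl -mulmxA Ea mulmx0 subr0.
- by rewrite mulmxBl -mulmxA Eb mulmx0 subr0.
- by rewrite (bigD1 k0) //= mxE mxE [X in _ + X]mxE Ew // mxE !eqxx subrr mul0r.
- move=> k; rewrite mxE mxE [X in _ + X]mxE -rowE mxE.
  apply: le_trans (le_normcD _ _) _; rewrite normcN normc1.
  by rewrite -[n.+4]addn1 natrD addrC lerD2r.
Qed.

(** Only the two pivot factors have a constant term; each of the other [n] contributes a factor
    ['X]. *)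
Lemma coef_pivot_prod (C : comNzRingType) (n : nat) (i j : 'I_n.+2)
    (w : 'I_n.+2 -> C) :
  let T := \prod_k (((k == i) || (k == j))%:R%:P + w k *: 'X) in
  i != j ->
  (forall k, (k < n)%N -> T`_k = 0) /\
  T`_n = \prod_(k | (k != i) && (k != j)) w k.
Proof.
move=> T ij.
have -> : T = ((1 + w i *: 'X) * (1 + w j *: 'X)
   * (\prod_(k | (k != i) && (k != j)) w k)%:P) * 'X^n.
  rewrite /T (bigD1 i) //= (bigD1 j) 1?eq_sym //= !eqxx orbT -!mulrA.
  congr (_ * (_ * _)).
  under eq_bigr => k /andP[/negbTE -> /negbTE ->] do rewrite /= add0r -mul_polyC.
  rewrite big_split /= rmorph_prod; congr (_ * _).
  by rewrite prodr_const card_predC_pair.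
split=> [k kn|]; rewrite coefMXn ?kn // ltnn subnn -!horner_coef0 !hornerE.
by rewrite ?mulr0 ?addr0 ?mul1r.
Qed.

Lemma size_prod_affine_le (C : comNzRingType) (I : finType) (a b : I -> C) :
  (size (\prod_i ((a i)%:P + b i *: 'X))%R <= #|I|.+1)%N.
Proof.
apply: leq_trans (size_prod_leq _ _) _.
have -> : (#|I|.+1 = (\sum_(i : I) 2).+1 - #|I|)%N.
  by rewrite sum_nat_const muln2 -addnn -addSn addnK.
rewrite leq_sub2r // ltnS; apply: leq_sum => i _.
apply: leq_trans (size_polyD _ _) _; rewrite geq_max (leq_trans (size_polyC_leq1 _)) //.
by apply: leq_trans (size_scale_leq _ _) _; rewrite size_polyX.
Qed.

(** * The exponential bound for a product plus a function of two forms *)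

Section ProductPlusTwoForms.
Variable R : rcfType.

(* [Phi] stands for [(a, b) |-> (a + a0)^e + (b + b0)^e], but only its being a
   function of two linear forms matters. *)
Lemma product_plus_two_forms_bound (D e : nat) : (0 < D)%N -> exists B delta : R, 0 < delta /\
  forall (u v : 'I_e -> 'cV[R[i]]_D.+2) (c : 'I_e -> R[i])
    (u1 v1 u2 v2 : 'cV[R[i]]_D.+2) (Phi : R[i] -> R[i] -> R[i]),
  (forall X Y : 'rV_D.+2, (forall k, normc (X 0 k) <= B) ->
     (forall k, normc (Y 0 k) <= B) ->
     normc (\prod_r ((X *m u r) 0 0 + (Y *m v r) 0 0 + c r)
            + Phi ((X *m u1 + Y *m v1) 0 0) ((X *m u2 + Y *m v2) 0 0)
            - (\prod_k X 0 k + \prod_k Y 0 k)) <= delta) ->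
  (2 ^ D <= e * D.+1)%N.
Proof.
move=> D0.
(* More interpolation nodes than the degree of either product in [t]. *)
pose N := (maxn e D.+2).+1.
have [K [K0 interp]] := coef_bound_of_values R N.
(* Chosen so that [2 ^ D] rows with error [2 * D * eta] have total error [1/8]. *)
pose eta : R := (2 ^+ D * (16 * D%:R))^-1.
have D1 : 1 <= D%:R :> R by rewrite ler1n.
have pow1 : 1 <= 2 ^+ D :> R by rewrite exprn_ege1 // ler1n.
have eta_gt0 : 0 < eta by rewrite invr_gt0; nra.
have etaE : 2 ^+ D * D%:R * eta = 16^-1.
  by rewrite /eta; field; rewrite !gt_eqF //; lra.
have Deta : D%:R * eta <= 16^-1 by rewrite -etaE -mulrA ler_peMl // mulr_ge0 // ltW.
pose delta := Num.min 8^-1 (eta / K).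
have delta_gt0 : 0 < delta by rewrite lt_min divr_gt0 // invr_gt0 ltr0n.
have delta8 : delta <= 8^-1 by rewrite ge_min lexx.
have Kdelta : K * delta <= eta.
  by rewrite mulrC -ler_pdivlMr // ge_min lexx orbT.
(* [D.+3] bounds [X0]; the other summand bounds [t * (w *m E)] for [t < N] and entries of [w] at
   most 2. *)
pose B : R := D.+3%:R + N%:R * (D.+2%:R * (2 * D.+2%:R)).
exists B, delta; split=> // u v c u1 v1 u2 v2 Phi close.
have base n : (0 < n)%N -> forall a b : 'cV[R[i]]_n.+2, exists X : 'rV[R[i]]_n.+2,
    [/\ X *m a = const_mx 1 *m a, X *m b = const_mx 1 *m b, \prod_k X 0 k = 0 &
      forall k, normc (X 0 k) <= n.+3%:R].
  by case: n => // n _; exact: kernel_shift_prod0.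
have [X0 [X0u1 X0u2 X0p X0B]] := base D D0 u1 u2.
have [i [j [E [ij EB Ev1 Ev2 Ew]]]] := kernel_two_forms v1 v2.
pose X1 : 'rV[R[i]]_D.+2 := const_mx 1.
pose Y0 : 'rV[R[i]]_D.+2 := \row_k ((k == i) || (k == j))%:R.
have D3B : D.+3%:R <= B by rewrite lerDl !mulr_ge0 ?ler0n.
have oneB : 1 <= B by apply: le_trans D3B; rewrite ler1n.
have Y01 k : normc (Y0 0 k) <= 1.
  by rewrite mxE; case: (_ || _); rewrite ?normc1 ?normc0 ?ler01.
have Y0B k : normc (Y0 0 k) <= B by exact: le_trans oneB.
pose alpha (X : 'rV[R[i]]_D.+2) r := (X *m u r) 0 0 + (Y0 *m v r) 0 0 + c r.
have [X [XB Xu1 Xu2 Xc]] : exists X : 'rV[R[i]]_D.+2,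
    [/\ forall k, normc (X 0 k) <= B, X *m u1 = X1 *m u1, X *m u2 = X1 *m u2 &
        4^-1 <= normc (\prod_r alpha X r)].
  have X0B' k : normc (X0 0 k) <= B by exact: le_trans D3B.
  have X1B' k : normc (X1 0 k) <= B by rewrite mxE normc1.
  have h0 := close X0 Y0 X0B' Y0B; have h1 := close X1 Y0 X1B' Y0B.
  have X1p : \prod_k X1 0 k = 1 by rewrite big1 // => k _; rewrite mxE.
  rewrite X0u1 X0u2 X0p -/X1 -/(alpha X0 _) add0r in h0; rewrite X1p in h1.
  have [l0|l0] := lerP 4^-1 (normc (\prod_r alpha X0 r)); first by exists X0.
  have [l1|l1] := lerP 4^-1 (normc (\prod_r alpha X1 r)); first by exists X1.
  (* [phi] is common to both points and cancels: 1 would be at most the two products plus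
     [2 * delta], hence below [3/4]. *)
  exfalso; move: l0 l1 h0 h1; rewrite /alpha.
  set p0 := \prod_r _; set p1 := \prod_r _; set phi := Phi _ _; set y := \prod_k _.
  move=> l0 l1 h0 h1.
  have : normc (p1 - p0 - (p1 + phi - (1 + y)) + (p0 + phi - y)) = 1.
    by rewrite -[RHS](normc1 R); congr normc; ring.
  have := le_normcD (p1 - p0 - (p1 + phi - (1 + y))) (p0 + phi - y).
  have := le_normcD (p1 - p0) (- (p1 + phi - (1 + y))).
  have := le_normcD p1 (- p0).
  rewrite !normcN; move: l0 l1 h0 h1 delta8; lra.
pose cc := \prod_r alpha X r.
have alpha0 r : alpha X r != 0.
  apply: contraTneq Xc => r0; rewrite (bigD1 r) //= r0 mul0r normc0 -ltNge.
  by rewrite invr_gt0 ltr0n.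
pose mu r (w : 'rV[R[i]]_D.+2) := (w *m E *m v r) 0 0 / alpha X r.
have muD r w w' : mu r (w + w') = mu r w + mu r w'.
  by rewrite /mu !mulmxDl mxE mulrDl.
have approx (w : 'rV[R[i]]_D.+2) : (forall k, normc (w 0 k) <= 2) ->
    normc (cc * (\sum_r mu r w ^+ D)
      - (-1) ^+ D.-1 * D%:R * \prod_(k | (k != i) && (k != j)) w 0 k) <= 2 * D%:R * eta.
  move=> w2.
  pose phi := Phi ((X *m u1 + Y0 *m v1) 0 0) ((X *m u2 + Y0 *m v2) 0 0).
  pose P := \prod_r (1 + mu r w *: 'X).
  pose T := \prod_k (((k == i) || (k == j))%:R%:P + (w *m E) 0 k *: 'X).
  (* [q] is the approximation error along [Y0 + t (w E)], a line on which [phi] is constant. Its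
     values at the integers [t < N] control its coefficients. *)
  pose q := cc *: P + (phi - \prod_k X 0 k)%:P - T.
  have qN : (size q <= N)%N.
    apply: leq_trans (size_polyD _ _) _; rewrite size_polyN geq_max.
    apply/andP; split; last first.
      by apply: leq_trans (size_prod_affine_le _ _) _; rewrite card_ord ltnS leq_maxr.
    apply: leq_trans (size_polyD _ _) _; rewrite geq_max.
    rewrite (leq_trans (size_polyC_leq1 _)) // andbT.
    apply: leq_trans (size_scale_leq _ _) _.
    by apply: leq_trans (size_prod_affine_le _ _) _; rewrite card_ord ltnS leq_maxl.
  have wE k : normc ((w *m E) 0 k) <= D.+2%:R * (2 * D.+2%:R).
    rewrite mxE; apply: le_trans (normc_sum _ _ _) _.
    apply: (@le_trans _ _ (\sum_(s < D.+2) 2 * D.+2%:R)).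
      by apply: ler_sum => s _; rewrite normcM ler_pM ?normc_ge0.
    by rewrite sumr_const card_ord [leRHS]mulr_natl.
  have val t : (t < N)%N -> normc q.[t%:R] <= delta.
    move=> tN; pose Y := Y0 + t%:R *: (w *m E).
    have YB k : normc (Y 0 k) <= B.
      rewrite mxE [X in _ + X]mxE; apply: le_trans (le_normcD _ _) _.
      rewrite normcM normc_nat; apply: lerD.
        by apply: le_trans (Y01 k) _; rewrite ler1n.
      by apply: ler_pM; rewrite ?ler0n ?normc_ge0 // ler_nat ltnW.
    have Yv1 : Y *m v1 = Y0 *m v1 by rewrite mulmxDl -scalemxAl -mulmxA Ev1 mulmx0 scaler0 addr0.
    have Yv2 : Y *m v2 = Y0 *m v2 by rewrite mulmxDl -scalemxAl -mulmxA Ev2 mulmx0 scaler0 addr0.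
    have := close X Y XB YB; rewrite Yv1 Yv2 -/phi; congr (normc _ <= _).
    have -> : \prod_r ((X *m u r) 0 0 + (Y *m v r) 0 0 + c r) = cc * P.[t%:R].
      rewrite /cc /P horner_prod -big_split; apply: eq_bigr => r _ /=.
      have -> : (X *m u r) 0 0 + (Y *m v r) 0 0 + c r
                = alpha X r + t%:R * (w *m E *m v r) 0 0.
        have -> : (Y *m v r) 0 0 = (Y0 *m v r) 0 0 + t%:R * (w *m E *m v r) 0 0.
          by rewrite mulmxDl -scalemxAl [LHS]mxE [X in _ + X = _]mxE.
        by rewrite /alpha; ring.
      rewrite hornerD hornerZ hornerX hornerC /mu mulrDr mulr1 mulrAC mulrCA.
      by rewrite divff // mulr1 mulrC.
    have -> : \prod_k Y 0 k = T.[t%:R].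
      rewrite /T horner_prod; apply: eq_bigr => k _.
      rewrite [LHS]mxE [X in _ + X = _]mxE [X in X + _ = _]mxE.
      by rewrite hornerD hornerZ hornerX hornerC [t%:R * _]mulrC.
    by rewrite /q !(hornerD, hornerN, hornerZ, hornerC); ring.
  have coefq := interp q delta (ltW delta_gt0) qN val.
  have [Tlow Ttop] := coef_pivot_prod (fun k => (w *m E) 0 k) ij.
  have wtop : T`_D = \prod_(k | (k != i) && (k != j)) w 0 k.
    by rewrite Ttop; apply: eq_bigr => k /andP[ki kj]; rewrite Ew.
  have coefqE k : (0 < k)%N -> q`_k = cc * P`_k - T`_k.
    by move=> k0; rewrite /q coefB coefD coefZ coefC gtn_eqF // addr0.
  apply: power_sum_approx => //; first exact: ltW.
  - by move: Deta; lra.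
  - move=> k /andP[k0 kD]; apply: le_trans Kdelta.
    by have := coefq k; rewrite coefqE // Tlow // subr0.
  - by apply: le_trans Kdelta; rewrite -wtop -coefqE.
pose sgn (S : {set 'I_D.+2}) : 'rV[R[i]]_D.+2 := \row_k (-1) ^+ (k \in S).
pose I := {S : {set 'I_D.+2} | S \subset ~: [set i; j]}.
have cardI : #|{: I}| = (2 ^ D)%N.
  rewrite card_sig -(eq_card (A := powerset (~: [set i; j]))); last first.
    by move=> S; rewrite powersetE.
  by rewrite card_powerset card_setC_pair.
have sgn2 S S' k : normc ((sgn S + sgn S') 0 k) <= 2.
  rewrite !mxE; apply: le_trans (le_normcD _ _) _.
  by rewrite !normcX normcN normc1 !expr1n; lra.
(* As [mu r] is additive, the binomial theorem separates [S] from [S'], with inner dimension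
   [e * D.+1]. *)
pose U (S : I) (rk : 'I_e * 'I_D.+1) :=
  cc * 'C(D, rk.2)%:R * mu rk.1 (sgn (val S)) ^+ (D - rk.2).
pose W (rk : 'I_e * 'I_D.+1) (S : I) := mu rk.1 (sgn (val S)) ^+ rk.2.
have UW S S' : \sum_rk U S rk * W rk S' = cc * \sum_r mu r (sgn (val S) + sgn (val S')) ^+ D.
  rewrite mulr_sumr.
  under [RHS]eq_bigr => r _ do rewrite muD exprDn mulr_sumr.
  rewrite [RHS]pair_big /=; apply: eq_bigr => -[r k] _ /=.
  by rewrite /U /W /= -mulr_natl; ring.
have -> : (e * D.+1)%N = #|{: 'I_e * 'I_D.+1}| by rewrite card_prod !card_ord.
rewrite -cardI.
apply: (@diag_dominant_card R _ _ U W (2 * D%:R * eta)) => [S|S S' SS'|].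
- rewrite UW; have := approx _ (sgn2 (val S) (val S)).
  set s := cc * _; set p := \prod_(k | _) _.
  (* On the diagonal the [D] free coordinates are [2] or [-2]; the main term [D * 2 ^ D >= 2]
     survives an error of at most [1/8]. *)
  have np : normc p = 2 ^+ D.
    rewrite /p normc_prod (eq_bigr (fun=> 2)) => [|k _]; last first.
      by rewrite !mxE -mulr2n normcMn normcX normcN normc1 expr1n.
    by rewrite prodr_const card_predC_pair.
  move=> h.
  have : normc ((-1) ^+ D.-1 * D%:R * p) = D%:R * 2 ^+ D.
    by rewrite 2!normcM normcX normcN normc1 expr1n mul1r normc_nat np.
  have -> : (-1) ^+ D.-1 * D%:R * p = s - (s - (-1) ^+ D.-1 * D%:R * p) by ring.
  have := le_normcD s (- (s - (-1) ^+ D.-1 * D%:R * p)); rewrite normcN => h1 h2.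
  have : 2 <= D%:R * 2 ^+ D :> R.
    case: (D) D0 D1 => // D' _ D1'; rewrite exprS.
    have : 1 <= 2 ^+ D' :> R by rewrite exprn_ege1 // ler1n.
    nra.
  by move: h h1 h2 Deta; lra.
- rewrite UW; have := approx _ (sgn2 (val S) (val S')).
  (* Distinct subsets differ at some [k], necessarily not a pivot, where the two signs cancel. *)
  have -> : \prod_(k | (k != i) && (k != j)) (sgn (val S) + sgn (val S')) 0 k = 0.
    have [k kSS'] : exists k, (k \in val S) != (k \in val S').
      apply/existsP; apply: contraNT SS' => /existsPn h.
      apply/eqP/val_inj/setP => k; apply/eqP.
      by have := h k; rewrite negbK.
    have out (S1 : I) l : l \in [set i; j] -> l \in val S1 = false.
      by move=> lij; apply/negbTE; apply: contraTN lij => /(subsetP (valP S1)); rewrite inE.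
    have kij : k \notin [set i; j].
      by apply: contraNN kSS' => kij; rewrite !out.
    rewrite (bigD1 k) /=; last by move: kij; rewrite !inE negb_or.
    rewrite !mxE; move: kSS'; case: (k \in _); case: (k \in _) => //= _;
      by rewrite ?expr0 ?expr1 ?subrr ?addNr mul0r.
  by rewrite mulr0 subr0.
- rewrite cardI natrX; move: etaE; lra.
Qed.

End ProductPlusTwoForms.

(** * Application to the two polynomials and final estimate *)

Lemma meval_P20 (C : numFieldType) (d : nat) (x : 'I_(d + d) -> C) :
  (P20 C d).@[x] = \prod_k x (lshift d k) + \prod_k x (rshift d k).
Proof.
by rewrite mevalD !rmorph_prod; congr (_ + _); apply: eq_bigr => k _; rewrite /= mevalXU.
Qed.

Lemma meval_affine_subst_P12 (C : numFieldType) (n e : nat) (A : 'M[C]_(e + 2, n))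
    (b : 'cV_(e + 2)) (x : 'I_n -> C) :
  let l r := \sum_j A r j * x j + b r 0 in
  (affine_subst (P12 C e) A b).@[x]
  = \prod_(r < e) l (lshift 2 r) + l (rshift e 0) ^+ e + l (rshift e 1) ^+ e.
Proof.
move=> l.
have lE r : (tnth [tuple \sum_(j < n) A i j *: 'X_j + (b i 0)%:MP | i < e + 2] r).@[x] = l r.
  rewrite tnth_mktuple mevalD mevalC raddf_sum; congr (_ + _).
  by apply: eq_bigr => j _; rewrite /= mevalZ mevalXU.
rewrite comp_mpoly_meval !mevalD !rmorphXn /= !mevalXU !lE rmorph_prod.
by congr (_ + _ + _); apply: eq_bigr => r _; rewrite /= mevalXU lE.
Qed.

(** Each row of [A] splits into its x-part and y-part; the constants of the last two forms are
    absorbed into [Phi]. *)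
Lemma aff_degen_P20_P12_bound (R : rcfType) (D e : nat) : (0 < D)%N ->
  aff_degen (P20 R[i] D.+2) (P12 R[i] e) -> (2 ^ D <= e * D.+1)%N.
Proof.
move=> D0 degen; have [B [delta [d0 main]]] := product_plus_two_forms_bound R e D0.
have [A [b close]] := aff_degen_pointwise B d0 degen.
pose Ax r : 'cV[R[i]]_D.+2 := \col_k A r (lshift _ k).
pose Ay r : 'cV[R[i]]_D.+2 := \col_k A r (rshift _ k).
apply: (main (fun r => Ax (lshift 2 r)) (fun r => Ay (lshift 2 r))
  (fun r => b (lshift 2 r) 0) (Ax (rshift e 0)) (Ay (rshift e 0))
  (Ax (rshift e 1)) (Ay (rshift e 1))
  (fun y z => (y + b (rshift e 0) 0) ^+ e + (z + b (rshift e 1) 0) ^+ e)).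
move=> X Y XB YB.
pose x (s : 'I_(D.+2 + D.+2)) := (row_mx X Y) 0 s.
have xl k : x (lshift _ k) = X 0 k by rewrite /x row_mxEl.
have xr k : x (rshift _ k) = Y 0 k by rewrite /x row_mxEr.
have xB s : normc (x s) <= B.
  by rewrite -(splitK s); case: (split s) => k /=; rewrite ?xl ?xr.
have lE r : \sum_s A r s * x s = (X *m Ax r) 0 0 + (Y *m Ay r) 0 0.
  rewrite big_split_ord /= !mxE; congr (_ + _); apply: eq_bigr => k _;
    by rewrite ?xl ?xr mxE mulrC.
apply: le_trans (close x xB); rewrite meval_P20 meval_affine_subst_P12 !lE addrA.
rewrite (eq_bigr _ (fun k _ => xl k)) (eq_bigr _ (fun k _ => xr k)).
by under [X in _ <= normc (X + _ + _ - _)]eq_bigr => r _ do rewrite lE; rewrite !mxE.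
Qed.

(** Half of the exponent is given up to absorb the factor [d.-1]. *)
Lemma exp_le_of_exp_le_mul (d e : nat) :
  (20 <= d)%N -> (2 ^ (d - 2) <= e * d.-1)%N -> (2 ^ (uphalf d) <= e)%N.
Proof.
move=> d20 h.
set k := uphalf d in h *.
have kd : (d <= 2 * k)%N by rewrite /k; lia.
have dk : (2 * k <= d.+1)%N by rewrite /k; lia.
have small : (d.-1 * 2 ^ k <= 2 ^ (d - 2))%N.
  have -> : (d - 2 = (d - 2 - k) + k)%N by lia.
  rewrite expnD leq_mul2r; apply/orP; right.
  (* For [m = d - 2 - k], [2 * m + 4 = 2 * d - 2 * k] is at least [d - 1], and [20 <= d] gives
     [7 <= m]. *)
  have grow m : (7 <= m)%N -> (2 * m + 4 <= 2 ^ m)%N.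
    elim: m => // m IH; rewrite leq_eqVlt => /predU1P[<- //|/IH].
    by rewrite expnS; lia.
  by apply: leq_trans (grow (d - 2 - k)%N _); lia.
have d0 : (0 < d.-1)%N by lia.
by rewrite -(leq_pmul2r d0) mulnC (leq_trans small).
Qed.

Theorem mainTheorem9 (R : realType) :
  exists (c : R) (d0 : nat), 0 < c /\
    forall d e : nat, (d0 <= d)%N ->
      aff_degen (P20 R[i] d) (P12 R[i] e) ->
      2 `^ (c * d%:R) <= e%:R.
Proof.
(* The rate [1/2] reflects [d / 2 <= uphalf d]. *)
exists 2^-1, 20%N; split; first by rewrite invr_gt0.
move=> [|[|D]] e // d20 degen.
have D0 : (0 < D)%N by lia.
have le : (2 ^ uphalf D.+2 <= e)%N.
  apply: exp_le_of_exp_le_mul => //; rewrite subn2.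
  exact: aff_degen_P20_P12_bound D0 degen.
apply: (@le_trans _ _ (2 `^ (uphalf D.+2)%:R)).
  apply: ler_powR; first by rewrite ler1n.
  rewrite ler_pdivrMl // -natrM ler_nat; lia.
by rewrite powR_mulrn // -natrX ler_nat.
Qed.
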